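(* One has $259\le f(3,7)\le474$.
   Context: $f(w,k)$ denotes the maximum size of a finite family of distinct $w$-element sets (on an arbitrary finite ground set) containing no $k$-sunflower. A $k$-sunflower is a collection of $k$ distinct sets $A_1,\dots,A_k$ for which there is a set $C$ (the core, possibly empty) with $A_i\cap A_j=C$ for all $i\ne j$. *)

(* Defs.v *)
From mathcomp Require Import all_boot.
From mathcomp Require Import boolp classical_sets.

Set Implicit Arguments.
Unset Strict Implicit.
Unset Printing Implicit Defensive.

(* A collection of distinct sets is a {set {set T}}, so that the pairwise
   condition only concerns A != B; the core C may be empty. *)
Definition is_sunflower (T : finType) (k : nat) (S : {set {set T}}) : Prop :=
  #|S| = k /\
  exists C : {set T}, forall A B : {set T},
    A \in S -> B \in S -> A != B -> A :&: B = C.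

Definition uniform (T : finType) (w : nat) (F : {set {set T}}) : Prop :=
  forall A : {set T}, A \in F -> #|A| = w.

Definition sunflower_free (T : finType) (k : nat) (F : {set {set T}}) : Prop :=
  forall S : {set {set T}}, S \subset F -> ~ is_sunflower k S.

Definition is_sunflower_max (w k n : nat) : Prop :=
  (exists (T : finType) (F : {set {set T}}),
     [/\ uniform w F, sunflower_free k F & #|F| = n]) /\
  (forall (T : finType) (F : {set {set T}}),
     uniform w F -> sunflower_free k F -> #|F| <= n).

Lemma is_sunflower_max_inj (w k m n : nat) :
  is_sunflower_max w k m -> is_sunflower_max w k n -> m = n.
Proof.
move=> [[T [F [uF sF <-]]] maxF] [[U [G [uG sG <-]]] maxG].
by apply/eqP; rewrite eqn_leq maxG // maxF.
Qed.

(* The maximum itself. The default 0 is only returned when there is no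
   maximum, so a positive lower bound on f w k entails that it exists. *)
Definition f (w k : nat) : nat := xget 0 (is_sunflower_max w k).

Lemma fE (w k n : nat) : is_sunflower_max w k n -> f w k = n.
Proof.
move=> max_n; apply: xget_unique => // m max_m.
exact: is_sunflower_max_inj max_m max_n.
Qed.

Lemma f_gt0_max (w k : nat) : 0 < f w k -> is_sunflower_max w k (f w k).
Proof. by rewrite /f; case: xgetP. Qed.

(* Main.v *)
Require Import Defs.
From mathcomp Require Import all_boot.
From mathcomp Require Import zify.
From mathcomp Require Import boolp.

(* Lower bound.  The orbit of PSL(2, 13) on triples of the projective line is a
   2-(14, 3, 6) design with 182 blocks: it has no 7-sunflower by counting points,
   and at most 4 disjoint blocks.  A cone over two disjoint copies of K_7 has 42
   triples, no 7-sunflower and no two disjoint triples.  The disjoint union of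
   the design and of two such cones has 182 + 2 * 42 = 266 triples, and no more
   than 4 + 1 + 1 < 7 of them are pairwise disjoint.

   Upper bound.  Links of points are graphs with maximum degree and matching
   number at most 6, hence have at most 42 edges (Chvatal-Hanson).  Let M be a
   maximum matching of F, V its vertex set.  For an edge e of M consider the
   triples meeting V in exactly one point, which lies in e.  If only one point of
   e occurs, these triples form a graph in its link with matching number at most
   5, since e itself extends every matching; so there are at most 33.  If several
   points of e occur, the corresponding graphs are cross-intersecting by
   maximality of M, hence small.  Counting incidences with V gives
   2 |F| + |M| <= (3 * 42 + 33) |M|, so |F| <= 79 |M| <= 474. *)

Set Implicit Arguments.
Unset Strict Implicit.
Unset Printing Implicit Defensive.

(** * Matchings *)

Definition matching (T : finType) (F M : {set {set T}}) : bool :=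
  (M \subset F) && trivIset M.

Definition matching_le (T : finType) (F : {set {set T}}) (n : nat) : Prop :=
  forall M : {set {set T}}, matching F M -> #|M| <= n.

Definition deg (T : finType) (F : {set {set T}}) (x : T) : nat :=
  #|[set A in F | x \in A]|.

Section SetFamilies.
Variable T : finType.
Implicit Types (F G M N S : {set {set T}}) (A B C : {set T}) (x y : T).

Lemma uniformS w F G : F \subset G -> uniform w G -> uniform w F.
Proof. by move=> sFG uG A /(subsetP sFG)/uG. Qed.

Lemma card_cover_uniform w M : uniform w M -> trivIset M -> #|cover M| = w * #|M|.
Proof.
by move=> uM /eqP <-; rewrite (eq_bigr (fun=> w)) // sum_nat_const mulnC.
Qed.

Lemma mem_cover M A x : A \in M -> x \in A -> x \in cover M.
Proof. by move=> MA Ax; apply/bigcupP; exists A. Qed.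

Lemma disjoint_set2 A x y :
  [disjoint [set x; y] & A] = (x \notin A) && (y \notin A).
Proof. by rewrite -setI_eq0 setIUl setU_eq0 !setI_eq0 !disjoints1. Qed.

Lemma trivIset_eq M A B x :
  trivIset M -> A \in M -> B \in M -> x \in A -> x \in B -> A = B.
Proof. by move=> tM MA MB Ax Bx; rewrite -(def_pblock tM MA Ax) (def_pblock tM MB Bx). Qed.

Lemma matching_add F M A x : matching F M -> A \in F -> x \in A ->
  [disjoint A & cover M] -> matching F (A |: M) /\ #|A |: M| = #|M|.+1.
Proof.
move=> /andP[sMF tM] FA Ax dAM; have MA : A \notin M.
  apply: contraL dAM => MA; apply/pred0Pn; exists x.
  by rewrite /= Ax (mem_cover MA).
split; last by rewrite cardsU1 MA.
rewrite /matching subUset sub1set FA sMF /=.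
by rewrite trivIsetU ?trivIset1 // cover1.
Qed.

Lemma sum_deg F A : \sum_(x in A) deg F x = \sum_(B in F) #|B :&: A|.
Proof.
have degE x : deg F x = \sum_(B in F | x \in B) 1.
  by rewrite /deg -sum1_card; apply: eq_bigl => B; rewrite inE.
rewrite (eq_bigr _ (fun x _ => degE x)).
rewrite (exchange_big_dep (fun B => B \in F)) /=; last by move=> ? ? _ /andP[].
apply: eq_bigr => B FB; rewrite -sum1_card; apply: eq_bigl => x.
by rewrite inE FB /= andbC.
Qed.

Lemma matching_pos F A x n : matching_le F n -> A \in F -> x \in A -> 0 < n.
Proof.
move=> maxn FA Ax; have M0 : matching F set0.
  by rewrite /matching sub0set /trivIset /cover !big_set0 cards0 eqxx.
have [| /maxn h e] := matching_add M0 FA Ax.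
  by rewrite /cover big_set0 -setI_eq0 setI0.
by apply: leq_trans h; rewrite e.
Qed.

Lemma matching_le_avoid F x n :
  (forall M, matching F M -> #|M| = n.+1 -> x \in cover M) ->
  matching_le F n.+1 -> matching_le [set A in F | x \notin A] n.
Proof.
move=> cov maxn M /andP[/subsetP sMF tM].
have mM : matching F M.
  by rewrite /matching tM andbT; apply/subsetP => A /sMF; rewrite inE => /andP[].
have := maxn _ mM; rewrite leq_eqVlt => /predU1P[/(cov _ mM)|//].
by case/bigcupP => A /sMF; rewrite inE => /andP[_ /negPf->].
Qed.

End SetFamilies.

(** * Gallai's lemma for maximum matchings of a graph *)

Section GraphMatching.
Variables (T : finType) (G : {set {set T}}) (n : nat).
Hypotheses (uG : uniform 2 G) (maxG : matching_le G n).
Implicit Types (M N : {set {set T}}) (A B C : {set T}) (x y : T).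

Definition max_matching M : bool := matching G M && (#|M| == n).

(** Gallai's relation. Once every vertex is missed by some maximum matching, it is an equivalence,
    and every edge lies inside one class. Equality is adjoined to make it reflexive. *)
Definition inseparable x y : bool :=
  (x == y) || [forall M, max_matching M ==> (x \in cover M) || (y \in cover M)].

Lemma max_matching_cover M : max_matching M -> #|cover M| = n.*2.
Proof.
case/andP => /andP[sMG tM] /eqP <-.
by rewrite (card_cover_uniform (uniformS sMG uG) tM) mul2n.
Qed.

Lemma inseparableP x y M :
  inseparable x y -> x != y -> max_matching M -> x \notin cover M -> y \in cover M.
Proof.
move=> /predU1P[-> /eqP //|/forallP/(_ M)/implyP h] _ /h.
by case/orP => [->|].
Qed.

Lemma inseparable_refl x : inseparable x x.
Proof. by rewrite /inseparable eqxx. Qed.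

Lemma inseparable_sym x y : inseparable x y = inseparable y x.
Proof.
by rewrite /inseparable eq_sym; congr orb; apply: eq_forallb => M; rewrite orbC.
Qed.

(** An edge with both ends missed by a maximum matching would extend it. *)
Lemma inseparable_edge A x y : A \in G -> x \in A -> y \in A -> inseparable x y.
Proof.
move=> GA Ax Ay; have [->|xy] := eqVneq x y; first exact: inseparable_refl.
apply/orP; right; apply/forallP => M; apply/implyP => /andP[mM /eqP cM].
apply: contraT; rewrite negb_or => /andP[xM yM].
have defA : A = [set x; y].
  apply/eqP; rewrite eq_sym eqEcard subUset !sub1set Ax Ay /=.
  by rewrite (uG GA) cards2 xy.
have dA : [disjoint A & cover M].
  by rewrite defA disjoint_set2 xM.
have [mM' cM'] := matching_add mM GA Ax dA.
by move: (maxG mM'); rewrite cM' cM ltnn.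
Qed.

(* Gallai's lemma.  Given a maximum matching M missing x and z, choose a maximum
   matching N missing y that shares as many edges as possible with M; since N
   covers x and z, M covers a vertex a <> y missed by N, and exchanging an edge
   of N for the edge of M through a brings N closer to M. *)
Lemma inseparable_trans y x z :
  (exists2 N, max_matching N & y \notin cover N) ->
  inseparable x y -> inseparable y z -> inseparable x z.
Proof.
move=> [N0 maxN0 N0y] ixy iyz.
have [exy|xy] := eqVneq x y; first by rewrite exy.
have [<-//|yz] := eqVneq y z.
have [->|xz] := eqVneq x z; first exact: inseparable_refl.
apply/orP; right; apply/forallP => M; apply/implyP => maxM.
apply: contraT; rewrite negb_or => /andP[Mx Mz].
pose P N := max_matching N && (y \notin cover N).
have PN0 : P N0 by rewrite /P maxN0.
case: (arg_maxnP (fun N => #|M :&: N|) PN0) => N /andP[maxN Ny] bestN.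
have Nx : x \in cover N by apply: inseparableP maxN Ny; rewrite 1?inseparable_sym // eq_sym.
have Nz : z \in cover N by apply: inseparableP maxN Ny.
have [a /andP[aM aN] ay] : exists2 a, (a \in cover M) && (a \notin cover N) & a != y.
  (* Both covers have [n.*2] points, so their two differences are equally large, and one of these
     contains [x] and [z]. *)
  have lt1 : 1 < #|cover M :\: cover N|.
    have -> : #|cover M :\: cover N| = #|cover N :\: cover M|.
      by rewrite !cardsD setIC (max_matching_cover maxM) (max_matching_cover maxN).
    apply: (@leq_trans #|[set x; z]|); first by rewrite cards2 xz.
    by rewrite subset_leq_card // subUset !sub1set !inE Nx Nz Mx Mz.
  have /card_gt0P[a] : 0 < #|(cover M :\: cover N) :\ y|.
    by move: lt1; rewrite (cardsD1 y (cover M :\: cover N)); case: (y \in _) => [|/ltnW].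
  by rewrite !inE => /and3P[ay aN aM]; exists a; rewrite ?aM.
have [/andP[sMG tM] /eqP cM] := andP maxM; have [mN /eqP cN] := andP maxN.
have [sNG tN] := andP mN.
have [e Me ea] := bigcupP aM.
have Ge := subsetP sMG _ Me.
(* Otherwise [e] would extend [N]. *)
have [b eb Nb] : exists2 b, b \in e & b \in cover N.
  have [dN|] := boolP [disjoint e & cover N].
    have [mN' cN'] := matching_add mN Ge ea dN.
    by move: (maxG mN'); rewrite cN' cN ltnn.
  by case/pred0Pn => b /andP[]; exists b.
have ab : a != b by apply: contraNneq aN => ->.
have defe : e = [set a; b].
  apply/eqP; rewrite eq_sym eqEcard subUset !sub1set ea eb /=.
  by rewrite (uG Ge) cards2 ab.
have [g Ng gb] := bigcupP Nb.
have Ncov' : cover (N :\ g) = cover N :\: g by rewrite coverD1.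
have mN' : matching G (N :\ g).
  rewrite /matching (subset_trans _ sNG) ?subD1set //.
  by rewrite trivIsetD.
have de : [disjoint e & cover (N :\ g)].
  by rewrite Ncov' defe disjoint_set2 !inE !negb_and ?aN ?gb ?orbT.
have [mN2 cN2] := matching_add mN' Ge ea de.
(* Since [a] differs from [y], and [b] is covered by [N] while [y] is not, trading [g] for [e]
   leaves [y] uncovered. *)
have PN2 : P (e |: N :\ g).
  have cNg : #|e |: N :\ g| == n by rewrite cN2 -cN (cardsD1 g N) Ng.
  have covN2 : cover (e |: N :\ g) = e :|: cover N :\: g.
    by rewrite /cover bigcup_setU big_set1 -/(cover _) Ncov'.
  rewrite /P /max_matching mN2 cNg covN2 inE negb_or /= in_setD (negPf Ny) andbF andbT.
  rewrite defe !inE negb_or eq_sym ay /=.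
  by apply: contraNneq Ny => ->.
(* The exchange gains [e] and loses nothing of [M]: were [g] in [M], it would equal [e] and [N]
   would cover [a]. *)
suff : #|M :&: N| < #|M :&: (e |: N :\ g)| by move=> h; have := leq_trans h (bestN _ PN2); rewrite ltnn.
have Ne : e \notin N by apply: contraNN aN => /mem_cover; apply.
have Mg : g \notin M.
  apply: contraNN aN => Mg; rewrite (mem_cover Ng) //.
  by rewrite -(trivIset_eq tM Me Mg eb gb).
have -> : M :&: (e |: N :\ g) = e |: (M :&: N).
  apply/setP => h; rewrite !inE; have [->|] := eqVneq h e; first by rewrite Me.
  by move=> _ /=; have [->|//] := eqVneq h g; rewrite (negPf Mg).
by rewrite cardsU1 !inE (negPf Ne) andbF.
Qed.

End GraphMatching.

(** * Graphs of bounded degree and matching number *)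

(** Bounds the edges of a class with [c] points and [a] matching edges. If [a < r], there are at
    most [a * (2 * a + 1) <= 2 * r * a] pairs of points. Otherwise the degree bound gives
    [r * (2 * a + 1)], so the excess [r] is paid only when [r <= a]. *)
Lemma class_edges_le r g c a :
  g <= 'C(c, 2) -> 2 * g <= 2 * r * c -> c <= (2 * a).+1 ->
  g <= 2 * r * a + r * (r <= a).
Proof.
move=> gc gr ca; case: (leqP r a) => ra.
  have : g <= r * (2 * a).+1.
    rewrite -(leq_pmul2l (isT : 0 < 2)) (leq_trans gr) // -mulnA.
    by rewrite !leq_mul2l ca !orbT.
  by clear; nia.
apply: leq_trans (leq_addr _ _); rewrite (leq_trans gc) // (leq_trans (leq_bin2l _ ca)) //.
rewrite bin2 /= mulnC -mulnA mul2n doubleK.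
by move: ra; clear; nia.
Qed.

Section GraphBound.
Variables (T : finType) (G : {set {set T}}) (n : nat).
Hypotheses (uG : uniform 2 G) (maxG : matching_le G n).
Implicit Types (M N : {set {set T}}) (A B C : {set T}) (x y : T).

Hypothesis avoidable : forall x, exists2 N, max_matching G n N & x \notin cover N.

Let cl x := [set y | inseparable G n x y].

(* For an edge A this is a single inseparability class, see [hull_edge]. *)
Let hull A := \bigcup_(x in A) cl x.

Let cl_eq x y : inseparable G n x y -> cl x = cl y.
Proof.
move=> ixy; apply/setP => z; rewrite !inE.
apply/idP/idP; apply: inseparable_trans => //.
by rewrite inseparable_sym.
Qed.

Let hull_edge A x : A \in G -> x \in A -> hull A = cl x.
Proof.
move=> GA Ax; apply/setP => z; apply/bigcupP/idP => [[y Ay zy]|zx]; last by exists x.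
by rewrite (cl_eq (inseparable_edge uG maxG GA Ax Ay)).
Qed.

(** Edges of [M] meeting a class lie inside it, and no two points of a class are both missed by [M];
    so at most one point is left over. *)
Let cl_cover_le M C x : max_matching G n M -> C = cl x ->
  #|C| <= (2 * #|[set A in M | hull A == C]|).+1.
Proof.
move=> maxM defC; have [/andP[sMG tM] /eqP cM] := andP maxM.
set MC := [set A in M | _].
have sMC : MC \subset M by apply/subsetP => A; rewrite inE => /andP[].
rewrite -(card_cover_uniform (uniformS (subset_trans sMC sMG) uG) (trivIsetS sMC tM)).
rewrite -(cardsID (cover MC) C) -addn1 leq_add ?subset_leq_card ?subsetIr //.
apply/card_le1_eqP => y z; rewrite !inE.
have nMC u : u \in C -> u \notin cover MC -> u \notin cover M.
  move=> Cu; apply: contraNN => /bigcupP[A MA Au]; apply: (@mem_cover _ _ A) => //.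
  rewrite inE MA (hull_edge (subsetP sMG _ MA) Au) defC; apply/eqP.
  by apply: cl_eq; rewrite inseparable_sym; move: Cu; rewrite defC inE.
move=> /andP[yMC Cy] /andP[zMC Cz]; apply/eqP; apply: contraT => zy.
have iyz : inseparable G n z y.
  move: Cy Cz; rewrite defC => Cy Cz.
  have : y \in cl z; last by rewrite inE.
  by rewrite -(@cl_eq x z) //; move: Cz; rewrite inE.
have := inseparableP iyz _ maxM (nMC _ Cz zMC).
by rewrite (negPf (nMC _ Cy yMC)) => /(_ zy).
Qed.

(** Every edge lies in a single class, so the class bounds add up. The classes share the [n] edges
    of a maximum matching, so for [r > 0] at most [n %/ r] of them contain [r] or more. *)
Lemma graph_le_avoidable r : (forall x, deg G x <= 2 * r) ->
  #|G| <= 2 * r * n + r * (n %/ r).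
Proof.
move=> degG.
have [->|[A0 GA0]] := set_0Vmem G; first by rewrite cards0.
have [x0 _] : exists x, x \in A0.
  by apply/set0Pn; rewrite -card_gt0 (uG GA0).
have [M maxM _] := avoidable x0; have [/andP[sMG tM] /eqP cM] := andP maxM.
have split_card (F : {set {set T}}) : #|F| = \sum_C #|[set A in F | hull A == C]|.
  rewrite -sum1_card (partition_big hull xpredT) //=.
  apply: eq_bigr => C _; rewrite -sum1_card; apply: eq_bigl => A.
  by rewrite inE.
pose a C := #|[set A in M | hull A == C]|.
have le_a C : #|[set A in G | hull A == C]| <= 2 * r * a C + r * (r <= a C).
  set GC := [set A in G | _]; have [->|[A]] := set_0Vmem GC; first by rewrite cards0.
  rewrite inE => /andP[GA /eqP hA].
  have [x Ax] : exists x, x \in A by apply/set0Pn; rewrite -card_gt0 (uG GA).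
  have defC : C = cl x by rewrite -hA (hull_edge GA Ax).
  have sub_C B : B \in GC -> B \subset C.
    rewrite inE => /andP[GB /eqP <-]; apply/subsetP => y By.
    by rewrite (hull_edge GB By) inE inseparable_refl.
  apply: (@class_edges_le _ _ #|C|).
  - rewrite -cards_draws; apply/subset_leq_card/subsetP => B GCB; rewrite inE sub_C //=.
    by move: GCB; rewrite inE => /andP[/uG->].
  - have -> : 2 * #|GC| = \sum_(B in GC) #|B :&: C|.
      rewrite mulnC -sum_nat_const; apply: eq_bigr => B GCB.
      by rewrite (setIidPl (sub_C _ GCB)) uG //; move: GCB; rewrite inE => /andP[].
    rewrite -sum_deg mulnC -sum_nat_const; apply: leq_sum => y _.
    apply: leq_trans (degG y); apply/subset_leq_card/subsetP => B.
    by rewrite !inE -andbA => /and3P[-> _].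
  - exact: cl_cover_le maxM defC.
rewrite split_card (leq_trans (leq_sum _ (fun C _ => le_a C))) //.
have sum_a : \sum_C a C = n by rewrite -cM split_card.
rewrite big_split /= -!big_distrr /= sum_a leq_add2l.
have [->|r0] := posnP r; first by rewrite mul0n.
rewrite leq_mul2l leq_divRL // -sum_a big_distrl /=; apply/orP; right.
by apply: leq_sum => C _; case: (leqP r (a C)); rewrite ?mul1n ?mul0n.
Qed.

End GraphBound.

(* The bound of Chvatal and Hanson for even maximum degree; it is attained by
   disjoint copies of the complete graph on [2 * r + 1] vertices. *)
Theorem graph_le (T : finType) (G : {set {set T}}) (n r : nat) :
  uniform 2 G -> (forall x, deg G x <= 2 * r) -> matching_le G n ->
  #|G| <= 2 * r * n + r * (n %/ r).
Proof.
elim: n G => [|n IHn] G uG degG maxG.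
  have [->|[A GA]] := set_0Vmem G; first by rewrite cards0.
  have [x Ax] : exists x, x \in A by apply/set0Pn; rewrite -card_gt0 (uG _ GA).
  by have := matching_pos maxG GA Ax.
(* Either every vertex is missed by some matching with [n.+1] edges, or some [x] is missed by none;
   deleting [x] then costs at most [2 * r] edges and lowers the matching bound by one. *)
have [/forallP cov|/forallPn[x /negbNE/forallP cov]] := boolP
    [forall x, ~~ [forall M, max_matching G n.+1 M ==> (x \in cover M)]].
  apply: graph_le_avoidable => // x.
  have /forallPn[M] := cov x; rewrite negb_imply => /andP[maxM xM].
  by exists M.
pose G' := [set A in G | x \notin A].
have sG' : G' \subset G by apply/subsetP => A; rewrite inE => /andP[].
have leG' : #|G'| <= 2 * r * n + r * (n %/ r).
  apply: IHn; first exact: uniformS uG.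
    move=> y; apply: leq_trans (degG y); apply/subset_leq_card/subsetP => A.
    by rewrite !inE -andbA => /and3P[-> _].
  apply: matching_le_avoid => // M mM cM.
  by apply: (implyP (cov M)); rewrite /max_matching mM cM eqxx.
have -> : #|G| = deg G x + #|G'|.
  rewrite -(cardsID [set A : {set T} | x \in A]) /deg.
  by congr (_ + _); apply: eq_card => A; rewrite !inE // andbC.
rewrite (leq_trans (leq_add (degG x) leG')) // mulnS -addnA leq_add2l leq_add2l.
by rewrite leq_mul2l leq_div2r ?orbT.
Qed.

(** * Upper bound *)

Lemma subset_of_card (T : finType) (A : {set T}) k :
  k <= #|A| -> exists2 B : {set T}, B \subset A & #|B| = k.
Proof.
case/card_geqP => s [us ss /subsetP sA]; exists [set x in s].
  by apply/subsetP => x; rewrite inE => /(subsetP sA).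
by rewrite cardsE (card_uniqP us).
Qed.

(** [is_sunflower] asks for exactly [k] petals; a larger sunflower is cut down to [k] of them. *)
Lemma sunflower_free_lt (T : finType) k (F S : {set {set T}}) (C : {set T}) :
  sunflower_free k F -> S \subset F ->
  (forall A B, A \in S -> B \in S -> A != B -> A :&: B = C) -> #|S| < k.
Proof.
move=> freeF sSF coreS; rewrite ltnNge; apply/negP => /subset_of_card[S' sS' cS'].
apply: (freeF S'); first exact: subset_trans sSF.
by split=> //; exists C => A B /(subsetP sS') SA /(subsetP sS') SB; apply: coreS.
Qed.

Lemma sunflower_free_matching (T : finType) k (F : {set {set T}}) :
  sunflower_free k.+1 F -> matching_le F k.
Proof.
move=> freeF M /andP[sMF /trivIsetP tM]; rewrite -ltnS.
by apply: (sunflower_free_lt freeF sMF (C := set0)) => A B MA MB /(tM _ _ MA MB)/disjoint_setI0.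
Qed.

(** * Links and codegrees *)

Definition link (T : finType) (F : {set {set T}}) (x : T) : {set {set T}} :=
  [set A :\ x | A in F & x \in A].

Section Link.
Variables (T : finType) (F : {set {set T}}).
Implicit Types (A B : {set T}) (x y : T).

Lemma linkP x B : reflect (exists A, [/\ A \in F, x \in A & B = A :\ x]) (B \in link F x).
Proof.
apply: (iffP imsetP) => [[A]|[A [FA Ax ->]]]; last by exists A; rewrite ?inE ?FA.
by rewrite inE => /andP[FA Ax] ->; exists A.
Qed.

Lemma card_link x : #|link F x| = deg F x.
Proof.
rewrite card_in_imset; first by apply: eq_card => A; rewrite !inE.
move=> A B; rewrite !inE => /andP[_ Ax] /andP[_ Bx] eqAB.
by rewrite -(setD1K Ax) eqAB setD1K.
Qed.

Lemma uniform_link w x : uniform w.+1 F -> uniform w (link F x).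
Proof.
by move=> uF B /linkP[A [/uF cA Ax ->]]; move: cA; rewrite (cardsD1 x) Ax => -[].
Qed.

(** Putting [x] back into a matching of the link gives a sunflower with core [[set x]]. *)
Lemma link_matching k x : sunflower_free k.+1 F -> matching_le (link F x) k.
Proof.
move=> freeF M /andP[sM /trivIsetP tM].
have Mx B : B \in M -> x \notin B.
  by move/(subsetP sM)/linkP => [A [_ _ ->]]; rewrite !inE eqxx.
rewrite -ltnS -(card_in_imset (f := fun B => x |: B) (D := mem M)); last first.
  by move=> A B /Mx Ax /Mx Bx /(congr1 (fun A => A :\ x)); rewrite !setU1K.
apply: (sunflower_free_lt freeF (C := [set x])).
  apply/subsetP => _ /imsetP[B MB ->].
  by have /linkP[A [FA Ax ->]] := subsetP sM _ MB; rewrite setD1K.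
move=> _ _ /imsetP[A MA ->] /imsetP[B MB ->] neqAB.
rewrite -setUIr disjoint_setI0 ?setU0 // tM //.
by apply: contraNneq neqAB => ->.
Qed.

End Link.

Section ThreeUniform.
Variables (T : finType) (F : {set {set T}}) (k : nat).
Hypotheses (uF : uniform 3 F) (freeF : sunflower_free k.+1 F).
Implicit Types (A B M : {set T}) (x y : T).

(** Distinct triples through [x] and [y] share nothing else, so they form a sunflower. *)
Lemma codeg_le x y : x != y -> #|[set A in F | (x \in A) && (y \in A)]| <= k.
Proof.
move=> xy; rewrite -ltnS; apply: (sunflower_free_lt freeF (C := [set x; y])).
  by apply/subsetP => A; rewrite inE => /andP[].
move=> A B; rewrite !inE => /and3P[FA Ax Ay] /and3P[FB Bx By] neqAB.
apply/esym/eqP; rewrite eqEcard subUset !sub1set !inE Ax Ay Bx By cards2 xy /=.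
rewrite -ltnS -(uF FA) ltn_neqAle subset_leq_card ?subsetIl // andbT.
apply: contraNneq neqAB => /eqP cAB; rewrite eqEcard (uF FA) (uF FB) leqnn andbT.
apply/setIidPl/eqP; rewrite eqEcard subsetIl /=.
by rewrite (eqP cAB).
Qed.

Lemma deg_link_le x y : deg (link F x) y <= k.
Proof.
rewrite /deg; have [->|xy] := eqVneq x y.
  rewrite (_ : [set _ in _ | _] = set0) ?cards0 //; apply/setP => B; rewrite !inE.
  by apply/andP => -[/linkP[A [_ _ ->]]]; rewrite !inE eqxx.
apply: leq_trans (codeg_le xy).
apply: leq_trans (leq_imset_card (fun A => A :\ x) _).
apply/subset_leq_card/subsetP => B; rewrite inE => /andP[/linkP[A [FA Ax ->]]].
rewrite !inE => /andP[_ Ay]; apply/imsetP; exists A => //.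
by rewrite inE FA Ax.
Qed.

End ThreeUniform.

(** * Triples meeting a maximum matching in one point *)

Section UpperBound.
Variables (T : finType) (F : {set {set T}}).
Hypotheses (uF : uniform 3 F) (freeF : sunflower_free 7 F).
Implicit Types (A B e : {set T}) (x y : T).

(** Chvatal-Hanson with [r = 3] and [n = 6]: [42 = 2 * 3 * 6 + 3 * (6 %/ 3)]. *)
Lemma deg_le x : deg F x <= 42.
Proof.
rewrite -card_link.
exact: (graph_le (r := 3) (uniform_link uF) (deg_link_le uF freeF x) (link_matching freeF)).
Qed.

Variable M : {set {set T}}.
Hypotheses (mM : matching F M) (maxM : matching_le F #|M|).
Let V := cover M.

Definition private x : {set {set T}} := [set A in F | A :&: V == [set x]].

Lemma privateP x A : A \in private x ->
  [/\ A \in F, x \in A & forall y, y \in A -> y \in V -> y = x].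
Proof.
rewrite inE => /andP[FA /eqP AV]; split=> // [|y Ay Vy].
  by have /setIP[] : x \in A :&: V by rewrite AV inE.
by apply/set1P; rewrite -AV inE Ay.
Qed.

(* The edge of M through x extends any matching of the private link of x. *)
Lemma private_matching e x : e \in M -> x \in e -> matching_le (link (private x) x) 5.
Proof.
move=> Me ex N /andP[sN tN]; have [sMF _] := andP mM.
have Fe := subsetP sMF _ Me.
have mN : matching (link F x) N.
  rewrite /matching tN andbT; apply/subsetP => B /(subsetP sN)/linkP[A [pA Ax ->]].
  by apply/linkP; exists A; have [] := privateP pA.
have [y yex] : exists y, y \in e :\ x.
  by apply/set0Pn; rewrite -card_gt0; have := uF Fe; rewrite (cardsD1 x) ex add1n => -[->].
have dN : [disjoint e :\ x & cover N].
  apply/pred0P => z; apply/negbTE/negP => /andP[/=].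
  rewrite inE => /andP[zx ez] /bigcupP[B /(subsetP sN)/linkP[A [pA _ ->]]].
  rewrite !inE => /andP[_ Az]; have [_ _ /(_ z Az)] := privateP pA.
  by move/(_ (mem_cover Me ez)) => exz; rewrite exz set11 in zx.
have lex : e :\ x \in link F x by apply/linkP; exists e.
have [mN' cN'] := matching_add mN lex yex dN.
by have := link_matching freeF mN'; rewrite cN'.
Qed.

(** Chvatal-Hanson with [r = 3] and [n = 5]: [33 = 2 * 3 * 5 + 3 * (5 %/ 3)]. *)
Lemma private_le e x : e \in M -> x \in e -> #|private x| <= 33.
Proof.
move=> Me ex; have sp : private x \subset F by apply/subsetP => A; rewrite inE => /andP[].
have -> : #|private x| = #|link (private x) x|.
  rewrite card_link; apply: eq_card => A; rewrite [RHS]inE.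
  by apply/idP/andP => [pA|[]//]; have [] := privateP pA.
apply: (graph_le (r := 3)) (private_matching Me ex).
- exact: uniform_link (uniformS sp uF).
- move=> y; apply: leq_trans (deg_link_le uF freeF x y).
  apply/subset_leq_card/subsetP => B; rewrite !inE => /andP[/linkP[A [pA Ax ->]] ->].
  by rewrite andbT; apply/linkP; exists A; rewrite (subsetP sp).
Qed.

(* If A and B were disjoint, replacing e by them would enlarge M. *)
Lemma private_cross e x y A B : e \in M -> x \in e -> y \in e -> x != y ->
  A \in private x -> B \in private y -> exists2 u, u \in A & u \in B.
Proof.
move=> Me ex ey xy pA pB; have [sMF tM] := andP mM.
have [FA Ax Aonly] := privateP pA; have [FB By Bonly] := privateP pB.
have [dAB|/pred0Pn[u /andP[]]] := boolP [disjoint A & B]; last by exists u.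
have mM' : matching F (M :\ e).
  by rewrite /matching (subset_trans _ sMF) ?subD1set // trivIsetD.
have cov : cover (M :\ e) = V :\: e by rewrite coverD1.
have [mM1 cM1] : matching F (A |: M :\ e) /\ #|A |: M :\ e| = #|M :\ e|.+1.
  apply: matching_add Ax _ => //; rewrite cov; apply/pred0P => z /=.
  apply/negbTE/negP => /andP[Az]; rewrite inE => /andP[ez Vz].
  by move: ez; rewrite (Aonly z) ?ex.
have cov1 : cover (A |: M :\ e) = A :|: V :\: e.
  by rewrite /cover bigcup_setU big_set1 -/(cover _) cov.
have [mM2 cM2] : matching F (B |: (A |: M :\ e)) /\
    #|B |: (A |: M :\ e)| = #|A |: M :\ e|.+1.
  apply: matching_add By _ => //; rewrite cov1; apply/pred0P => z /=.
  apply/negbTE/negP => /andP[Bz]; rewrite !inE => /orP[Az|/andP[ez Vz]].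
    by move/pred0P: dAB => /(_ z); rewrite /= Az Bz.
  by move: ez; rewrite (Bonly z) ?ey.
by have := maxM mM2; rewrite cM2 cM1 [#|M|](cardsD1 e) Me add1n ltnn.
Qed.

Lemma private_notin e x y B : e \in M -> x \in e -> x != y -> B \in private y -> x \notin B.
Proof.
move=> Me ex xy pB; have [_ _ Bonly] := privateP pB.
by apply: contraNN xy => Bx; apply/eqP/Bonly => //; apply: mem_cover ex.
Qed.

(** Fix [B = {y, u, v}] in [private y]. A triple private to [x] meets [B] but avoids [y], so it
    contains [u] or [v]; two codegrees give [6 + 6]. *)
Lemma private_le12 e x y : e \in M -> x \in e -> y \in e -> x != y ->
  0 < #|private y| -> #|private x| <= 12.
Proof.
move=> Me ex ey xy /card_gt0P[B pB]; have [FB By _] := privateP pB.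
have Bx := private_notin Me ex xy pB.
have /eqP/cards2P[u [v [uv defB]]] : #|B :\ y| = 2.
  by have := uF FB; rewrite (cardsD1 y) By => -[].
have [Bu Bv] : u \in B /\ v \in B.
  by split; apply: (subsetP (subD1set B y)); rewrite defB !inE eqxx ?orbT.
have xu : x != u by apply: contraNneq Bx => ->.
have xv : x != v by apply: contraNneq Bx => ->.
apply: leq_trans (leq_add (codeg_le uF freeF xu) (codeg_le uF freeF xv)).
apply: leq_trans (leq_card_setU _ _); apply/subset_leq_card/subsetP => A pA.
have [FA Ax _] := privateP pA; rewrite !inE FA Ax /=.
have [z Az Bz] := private_cross Me ex ey xy pA pB.
have : z \in B :\ y.
  rewrite !inE Bz andbT; apply: contraTneq Az => ->.
  by apply: private_notin Me ey _ pA; rewrite eq_sym.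
by rewrite defB !inE => /orP[] /eqP <-; rewrite Az ?orbT.
Qed.

(** Take [B = {y, u, v}] and [B'] in [private y] with [v] outside [B']. At most 6 triples private to
    [x] contain [u]. Any other contains [v] and one of the two points of [B'] other than [y], which
    leaves 2 triples. *)
Lemma private_le8 e x y : e \in M -> x \in e -> y \in e -> x != y ->
  1 < #|private y| -> #|private x| <= 8.
Proof.
move=> Me ex ey xy /card_gt1P[B [B' [pB pB' neqBB']]].
have [FB By _] := privateP pB; have [FB' By' _] := privateP pB'.
have Bx := private_notin Me ex xy pB; have Bx' := private_notin Me ex xy pB'.
have [v Bv Bv'] : exists2 v, v \in B & v \notin B'.
  by apply/subsetPn; apply: contraNN neqBB' => sBB'; rewrite eqEcard sBB' (uF FB) (uF FB').
have vy : v != y by apply: contraNneq Bv' => ->.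
have /eqP/cards1P[u defB] : #|B :\ y :\ v| = 1.
  have := uF FB; rewrite (cardsD1 y) By => -[]; rewrite (cardsD1 v).
  by rewrite !inE vy Bv => -[].
have Bu : u \in B.
  by have /setD1P[_ /setD1P[]] : u \in B :\ y :\ v by rewrite defB inE.
have xu : x != u by apply: contraNneq Bx => ->.
have xv : x != v by apply: contraNneq Bx => ->.
have cB' : #|B' :\ y| = 2 by have := uF FB'; rewrite (cardsD1 y) By' => -[].
have le2 := leq_imset_card (fun w => [set x; v; w]) (B' :\ y); rewrite cB' in le2.
apply: leq_trans (leq_add (codeg_le uF freeF xu) le2).
apply: leq_trans (leq_card_setU _ _); apply/subset_leq_card/subsetP => A pA.
have [FA Ax _] := privateP pA; rewrite !inE FA Ax /=.
have Ay : y \notin A by apply: private_notin Me ey _ pA; rewrite eq_sym.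
have [//|Au /=] := boolP (u \in A).
have [z Az Bz] := private_cross Me ex ey xy pA pB.
have Av : v \in A.
  apply: contraNT Au => Av; have : z \in B :\ y :\ v.
    by rewrite !inE Bz andbT; apply/andP; split; apply: contraTneq Az => ->.
  by rewrite defB inE => /eqP <-.
have [w Aw Bw'] := private_cross Me ex ey xy pA pB'.
apply/imsetP; exists w.
  by rewrite !inE Bw' andbT; apply: contraTneq Aw => ->.
apply/esym/eqP; rewrite eqEcard !subUset !sub1set Ax Av Aw (uF FA) /=.
rewrite -setUA !cardsU1 !inE cards1 (negPf xv).
have -> : (x == w) = false by apply/negbTE; apply: contraNneq Bx' => ->.
by have -> : (v == w) = false by apply/negbTE; apply: contraNneq Bv' => ->.
Qed.

Lemma sum_private_le e : e \in M -> \sum_(x in e) #|private x| <= 33.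
Proof.
move=> Me; have Fe : e \in F by have [/subsetP->] := andP mM.
have [x ex] : exists x, x \in e by apply/set0Pn; rewrite -card_gt0 uF.
have /eqP/cards2P[y [z [yz defe]]] : #|e :\ x| = 2.
  by have := uF Fe; rewrite (cardsD1 x) ex => -[].
rewrite (big_setD1 x) //= defe big_setU1 ?inE //= big_set1.
have : y \in e :\ x by rewrite defe !inE eqxx.
rewrite !inE => /andP[yx ey].
have : z \in e :\ x by rewrite defe !inE eqxx orbT.
rewrite !inE => /andP[zx ez].
have xy : x != y by rewrite eq_sym.
have xz : x != z by rewrite eq_sym.
have zy : z != y by rewrite eq_sym.
move: (private_le Me ex) (private_le Me ey) (private_le Me ez).
move: (private_le12 Me ex ey xy) (private_le12 Me ex ez xz) (private_le12 Me ey ex yx)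
      (private_le12 Me ey ez yz) (private_le12 Me ez ex zx) (private_le12 Me ez ey zy).
move: (private_le8 Me ex ey xy) (private_le8 Me ex ez xz) (private_le8 Me ey ex yx)
      (private_le8 Me ey ez yz) (private_le8 Me ez ex zx) (private_le8 Me ez ey zy).
(* With one nonempty private family the bound is 33, with two it is [12 + 12]. With three, either
   all are singletons or one has at least 2 members, and the sum is at most [12 + 8 + 8]. *)
move: #|private x| #|private y| #|private z| => a b c; clear; lia.
Qed.

Lemma card_le_matching : 2 * #|F| <= 158 * #|M|.
Proof.
have [sMF tM] := andP mM.
have sumM : \sum_(A in F) (A \in M) = #|M|.
  rewrite -sum1_card big_mkcond [RHS]big_mkcond; apply: eq_bigr => A _.
  by case: (boolP (A \in M)) => [/(subsetP sMF)->|_] //; case: ifP.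
have sumP : \sum_(x in V) #|private x| = \sum_(A in F) (#|A :&: V| == 1).
  have cp x : #|private x| = \sum_(A in F) (A :&: V == [set x]).
    rewrite -sum1_card big_mkcond [RHS]big_mkcond; apply: eq_bigr => A _.
    by rewrite inE; case: (A \in F).
  rewrite (eq_bigr _ (fun x _ => cp x)) exchange_big /=; apply: eq_bigr => A FA.
  have [/cards1P[x defx]|n1] := boolP (#|A :&: V| == 1).
    have /setIP[_ Vx] : x \in A :&: V by rewrite defx inE.
    rewrite (bigD1 x) //= defx eqxx big1 // => y /andP[_ yx].
    by rewrite (inj_eq set1_inj) eq_sym (negPf yx).
  by rewrite big1 // => x _; apply/eqP; rewrite eqb0; apply: contraNN n1 => /eqP->; rewrite cards1.
(* Triple by triple: a member of [M] has 3 points in [V] and counts [2 + 1] on the left; any other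
   triple meets [V], and if only once, its private term supplies the missing unit. *)
have count : 2 * #|F| + #|M| <= \sum_(x in V) deg F x + \sum_(x in V) #|private x|.
  rewrite sumP sum_deg -big_split mulnC -sum_nat_const -sumM -big_split /=.
  apply: leq_sum => A FA.
  have [MA|_] := boolP (A \in M).
    by rewrite (setIidPl _) ?uF //; apply/subsetP => x Ax; apply: mem_cover Ax.
  have : 0 < #|A :&: V|.
    have [x Ax] : exists x, x \in A by apply/set0Pn; rewrite -card_gt0 uF.
    rewrite lt0n cards_eq0 setI_eq0; apply/negP => dA.
    have [mM' cM'] := matching_add mM FA Ax dA.
    by have := maxM mM'; rewrite cM' ltnn.
  by case: #|A :&: V| => [|[|m]].
have degV : \sum_(x in V) deg F x <= 126 * #|M|.
  have -> : 126 * #|M| = 42 * (3 * #|M|) by rewrite mulnA.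
  rewrite -(card_cover_uniform (uniformS sMF uF) tM) mulnC -sum_nat_const.
  by apply: leq_sum => x _; apply: deg_le.
have privV : \sum_(x in V) #|private x| <= 33 * #|M|.
  rewrite big_trivIset //= mulnC -sum_nat_const.
  by apply: leq_sum => e; apply: sum_private_le.
move: count degV privV; move: (\sum_(x in V) _) (\sum_(x in V) _) #|M| #|F|.
by clear; lia.
Qed.

End UpperBound.

Theorem card_sunflower_free_3_7 (T : finType) (F : {set {set T}}) :
  uniform 3 F -> sunflower_free 7 F -> #|F| <= 474.
Proof.
move=> uF freeF; have m0 : matching F set0.
  by rewrite /matching sub0set /trivIset /cover !big_set0 cards0 eqxx.
case: (arg_maxnP (fun M : {set {set T}} => #|M|) m0) => M mM maxM.
have := card_le_matching uF freeF mM maxM.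
have := sunflower_free_matching freeF mM.
by move: #|F| #|M|; clear; lia.
Qed.

(** * Lower bound *)

Lemma matching_le_vertices (T : finType) (F : {set {set T}}) w n :
  uniform w F -> #|T| < w * n.+1 -> matching_le F n.
Proof.
move=> uF ltT M /andP[sMF tM]; rewrite leqNgt; apply/negP => ltM.
have := max_card (cover M); rewrite (card_cover_uniform (uniformS sMF uF) tM) leqNgt.
by rewrite (leq_trans ltT) // leq_mul2l ltM orbT.
Qed.

Lemma core_sub (T : finType) (S : {set {set T}}) (C A : {set T}) :
  1 < #|S| -> (forall A B, A \in S -> B \in S -> A != B -> A :&: B = C) ->
  A \in S -> C \subset A.
Proof.
move=> S1 coreS SA; have /card_gt0P[B] : 0 < #|S :\ A|.
  by move: S1; rewrite (cardsD1 A) SA.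
by rewrite !inE => /andP[BA SB]; rewrite -(coreS B A) // subsetIr.
Qed.

(** Outside the core the petals are pairwise disjoint. They cannot equal the core, since two
    distinct sets of size [w] contain it. *)
Lemma sunflower_vertices (T : finType) (S : {set {set T}}) (C : {set T}) w :
  uniform w S -> 1 < #|S| ->
  (forall A B, A \in S -> B \in S -> A != B -> A :&: B = C) ->
  #|C| < w /\ #|C| + #|S| * (w - #|C|) <= #|T|.
Proof.
move=> uS S1 coreS; have subC := core_sub S1 coreS; split.
  have /card_gt1P[A [B [SA SB AB]]] := S1.
  rewrite -(uS _ SA) ltn_neqAle subset_leq_card ?subC // andbT.
  apply: contraNneq AB => cC; have CA : C = A.
    by apply/eqP; rewrite eqEcard subC // cC /=.
  by rewrite eqEcard (uS _ SA) (uS _ SB) leqnn andbT -CA subC.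
rewrite -(cardsC C) leq_add2l.
have -> : #|S| * (w - #|C|) = \sum_(A in S) #|A :&: ~: C|.
  rewrite -sum_nat_const; apply: eq_bigr => A SA.
  by rewrite -setDE cardsD (setIidPr (subC _ SA)) (uS _ SA).
rewrite -sum_deg -sum1_card; apply: leq_sum => x; rewrite inE => Cx.
apply/card_le1_eqP => A B; rewrite !inE => /andP[SA Ax] /andP[SB Bx].
apply/eqP; apply: contraNT Cx => AB.
by rewrite -(coreS _ _ SB SA) ?inE ?Ax ?Bx // eq_sym.
Qed.

(** Preimages commute with intersections, so a sunflower pulls back along [f] to one whose core is
    the preimage of the core. This serves both disjoint unions and cones. *)
Lemma sunflower_free_imset (T U : finType) (f : T -> U) (g : {set T} -> {set U})
    k (F : {set {set T}}) :
  (forall A, f @^-1: g A = A) -> sunflower_free k F -> sunflower_free k (g @: F).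
Proof.
move=> fgK freeF S sS [cS [C coreS]].
pose p (B : {set U}) := f @^-1: B; apply: (freeF (p @: S)).
  by apply/subsetP => _ /imsetP[B /(subsetP sS)/imsetP[A FA ->] ->]; rewrite /p fgK.
split.
  rewrite card_in_imset // => _ _ /(subsetP sS)/imsetP[A _ ->] /(subsetP sS)/imsetP[B _ ->].
  by rewrite /p !fgK => ->.
exists (p C) => _ _ /imsetP[A SA ->] /imsetP[B SB ->] AB.
by rewrite -preimsetI coreS //; apply: contraNneq AB => ->.
Qed.

(** * Disjoint unions of families *)

Section Sum.
Variables T1 T2 : finType.
Implicit Types (F : {set {set T1}}) (G : {set {set T2}}).

Let in1 (A : {set T1}) : {set T1 + T2} := inl @: A.
Let in2 (A : {set T2}) : {set T1 + T2} := inr @: A.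

Definition sum_family F G : {set {set T1 + T2}} := in1 @: F :|: in2 @: G.

Let inl_inj : injective (@inl T1 T2). Proof. by move=> x y []. Qed.
Let inr_inj : injective (@inr T1 T2). Proof. by move=> x y []. Qed.

Let in1K A : inl @^-1: in1 A = A.
Proof. by apply/setP => x; rewrite inE mem_imset. Qed.

Let in2K A : inr @^-1: in2 A = A.
Proof. by apply/setP => x; rewrite inE mem_imset. Qed.

Let in1_inj : injective in1 := imset_inj inl_inj.
Let in2_inj : injective in2 := imset_inj inr_inj.

Lemma uniform_sum w F G : uniform w F -> uniform w G -> uniform w (sum_family F G).
Proof.
by move=> u1 u2 _ /setUP[] /imsetP[A FA ->]; rewrite card_imset // ?u1 ?u2.
Qed.

(** Positive uniformity of [F] excludes the empty set, the only set with equal images from both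
    sides. *)
Lemma card_sum w F G : uniform w.+1 F -> #|sum_family F G| = #|F| + #|G|.
Proof.
move=> u1; rewrite cardsU (card_imset _ in1_inj) (card_imset _ in2_inj).
rewrite (_ : _ :&: _ = set0) ?cards0 ?subn0 //; apply/setP => B; rewrite inE in_set0.
apply/negbTE/negP => /andP[/imsetP[A1 FA1 ->] /imsetP[A2 _ eqA]].
have [x Ax] : exists x, x \in A1 by apply/set0Pn; rewrite -card_gt0 u1.
have : inl x \in in2 A2 by rewrite -eqA mem_imset.
by case/imsetP.
Qed.

Lemma matching_le_sum n1 n2 F G :
  matching_le F n1 -> matching_le G n2 -> matching_le (sum_family F G) (n1 + n2).
Proof.
move=> max1 max2 M /andP[/subsetP sM /trivIsetP tM].
pose M1 := [set A in F | in1 A \in M]; pose M2 := [set A in G | in2 A \in M].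
have m1 : matching F M1.
  apply/andP; split; first by apply/subsetP => A; rewrite inE => /andP[].
  apply/trivIsetP => A B; rewrite !inE => /andP[_ MA] /andP[_ MB] AB.
  rewrite -(imset_disjoint inl_inj) tM //.
  by rewrite (inj_eq in1_inj).
have m2 : matching G M2.
  apply/andP; split; first by apply/subsetP => A; rewrite inE => /andP[].
  apply/trivIsetP => A B; rewrite !inE => /andP[_ MA] /andP[_ MB] AB.
  rewrite -(imset_disjoint inr_inj) tM //.
  by rewrite (inj_eq in2_inj).
apply: leq_trans (leq_add (max1 _ m1) (max2 _ m2)).
rewrite -(card_imset (mem M1) in1_inj) -(card_imset (mem M2) in2_inj).
apply: leq_trans (leq_card_setU _ _); apply/subset_leq_card/subsetP => B MB.
by case/setUP: (sM B MB) => /imsetP[A FA defB]; apply/setUP; [left|right];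
   apply/imsetP; exists A => //; rewrite inE FA -defB.
Qed.

(* A sunflower with a nonempty core lies on one side; one with empty core is a
   matching. *)
Lemma sunflower_free_sum k n1 n2 F G :
  sunflower_free k F -> sunflower_free k G -> matching_le F n1 -> matching_le G n2 ->
  1 < k -> n1 + n2 < k -> sunflower_free k (sum_family F G).
Proof.
move=> free1 free2 max1 max2 k1 ltk S sS sunS; have [cS [C coreS]] := sunS.
have subC A : A \in S -> C \subset A by apply: core_sub coreS; rewrite cS.
have [C0|[[x|x] Cx]] := set_0Vmem C.
- have mS : matching (sum_family F G) S.
    rewrite /matching sS; apply/trivIsetP => A B SA SB AB.
    by rewrite -setI_eq0 coreS // C0.
  by move: (leq_ltn_trans (matching_le_sum max1 max2 mS) ltk); rewrite cS ltnn.
- apply: (sunflower_free_imset in1K free1) sunS; apply/subsetP => A SA.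
  have /setUP[//|/imsetP[B _ defA]] := subsetP sS _ SA.
  by have := subsetP (subC A SA) _ Cx; rewrite defA => /imsetP[].
- apply: (sunflower_free_imset in2K free2) sunS; apply/subsetP => A SA.
  have /setUP[/imsetP[B _ defA]|//] := subsetP sS _ SA.
  by have := subsetP (subC A SA) _ Cx; rewrite defA => /imsetP[].
Qed.

End Sum.

(** * Cones *)

Section Cone.
Variable T : finType.
Implicit Types F : {set {set T}}.

Let add_apex (A : {set T}) : {set option T} := None |: Some @: A.

Definition cone F : {set {set option T}} := add_apex @: F.

Let add_apexK A : Some @^-1: add_apex A = A.
Proof. by apply/setP => x; rewrite !inE /= mem_imset //; apply: Some_inj. Qed.

Lemma uniform_cone w F : uniform w F -> uniform w.+1 (cone F).
Proof.
move=> uF _ /imsetP[A FA ->]; rewrite cardsU1 card_imset ?(uF _ FA); last exact: Some_inj.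
by rewrite (_ : None \notin _) //; apply/imsetP => -[].
Qed.

Lemma card_cone F : #|cone F| = #|F|.
Proof. by rewrite card_imset // => A B eqAB; rewrite -(add_apexK A) eqAB add_apexK. Qed.

Lemma sunflower_free_cone k F : sunflower_free k F -> sunflower_free k (cone F).
Proof. exact: sunflower_free_imset add_apexK. Qed.

Lemma matching_le_cone F : matching_le (cone F) 1.
Proof.
move=> M /andP[/subsetP sM tM]; apply/card_le1_eqP.
have apex A : A \in M -> None \in A by move/sM/imsetP => [B _ ->]; rewrite setU11.
by move=> A B MA MB; apply: trivIset_eq tM MB MA (apex _ MB) (apex _ MA).
Qed.

End Cone.

(** * The building blocks: cones over two copies of K_7, and the design *)

Definition K7 : {set {set 'I_7}} := [set A : {set 'I_7} | #|A| == 2].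

Lemma uniform_K7 : uniform 2 K7.
Proof. by move=> A; rewrite inE => /eqP. Qed.

(** Seven edges with core of size 0 or 1 need 14 or 8 points. *)
Lemma sunflower_free_K7 : sunflower_free 7 K7.
Proof.
move=> S sS [cS [C coreS]]; have S1 : 1 < #|S| by rewrite cS.
have := sunflower_vertices (uniformS sS uniform_K7) S1 coreS.
by rewrite cS card_ord; move: #|C|; clear; lia.
Qed.

Lemma matching_le_K7 : matching_le K7 3.
Proof. by apply: matching_le_vertices uniform_K7 _; rewrite card_ord. Qed.

Definition cone_2K7 := cone (sum_family K7 K7).

Lemma uniform_cone_2K7 : uniform 3 cone_2K7.
Proof. exact: uniform_cone (uniform_sum uniform_K7 uniform_K7). Qed.

Lemma card_cone_2K7 : #|cone_2K7| = 42.
Proof. by rewrite card_cone (card_sum _ uniform_K7) card_draws card_ord. Qed.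

Lemma sunflower_free_cone_2K7 : sunflower_free 7 cone_2K7.
Proof.
apply: sunflower_free_cone.
exact: sunflower_free_sum sunflower_free_K7 sunflower_free_K7 matching_le_K7 matching_le_K7 _ _.
Qed.

(* The points of 'I_14 stand for the projective line over the field with 13
   elements, 13 being the point at infinity.  The triples {u, v, w} for which
   (u - v) (v - w) (u - w) is a nonzero square (with factors involving the point
   at infinity dropped) form an orbit of PSL(2, 13); it is a 2-(14, 3, 6) design. *)
Definition line_diff (u v : nat) : nat :=
  if (u == 13) || (v == 13) then 1 else u + 13 - v.

Definition square_triple (u v w : nat) : bool :=
  line_diff u v * line_diff v w * line_diff u w %% 13 \in [:: 1; 3; 4; 9; 10; 12].

Definition design : {set {set 'I_14}} :=
  [set A : {set 'I_14} | (#|A| == 3) && [forall u in A, forall v in A, forall w in A,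
     [&& u != v, v != w & u != w] ==> square_triple u v w]].

Lemma uniform_design : uniform 3 design.
Proof. by move=> A; rewrite inE => /andP[/eqP]. Qed.

Lemma designP A u v w : A \in design -> u \in A -> v \in A -> w \in A ->
  u != v -> v != w -> u != w -> square_triple u v w.
Proof.
rewrite inE => /andP[_ /forall_inP h] Au Av Aw uv vw uw.
by move/forall_inP: (h u Au) => /(_ v Av)/forall_inP/(_ w Aw)/implyP; apply; rewrite uv vw.
Qed.

Lemma sum_ord_sumn n (h : nat -> nat) : \sum_(i < n) h i = sumn [seq h i | i <- iota 0 n].
Proof. by rewrite -(big_mkord xpredT) sumnE big_map /index_iota subn0. Qed.

Lemma all_iotaP (P : pred nat) n (i : 'I_n) : all P (iota 0 n) -> P i.
Proof. by move/allP; apply; rewrite mem_iota /=. Qed.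

(** A transposition changes the product at most by sign, and -1 is a square modulo 13. *)
Lemma square_tripleC (u v w : 'I_14) :
  square_triple u v w = square_triple v u w /\ square_triple u v w = square_triple u w v.
Proof.
have : all (fun i => all (fun j => all (fun k =>
    (square_triple i j k == square_triple j i k) &&
    (square_triple i j k == square_triple i k j)) (iota 0 14)) (iota 0 14)) (iota 0 14).
  by vm_compute.
by move/(all_iotaP u)/(all_iotaP v)/(all_iotaP w)/andP => [/eqP ? /eqP ?].
Qed.

(** A triple through [u] and [v] is determined by its third point, which lies in [W]; the size of
    [W] is found by computation. *)
Lemma design_codeg (u v : 'I_14) : u != v ->
  #|[set A in design | (u \in A) && (v \in A)]| <= 6.
Proof.
move=> uv; pose W := [set w : 'I_14 | [&& w != u, w != v & square_triple u v w]].
have cW : #|W| <= 6.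
  have : all (fun i => all (fun j => (i != j) ==>
      (sumn [seq nat_of_bool [&& k != i, k != j & square_triple i j k] | k <- iota 0 14] <= 6))
    (iota 0 14)) (iota 0 14) by vm_compute.
  move/(all_iotaP u)/(all_iotaP v)/implyP/(_ uv); rewrite -sum_ord_sumn => le6.
  apply: leq_trans le6; rewrite -sum1_card big_mkcond; apply: leq_sum => w _.
  by rewrite inE.
apply: leq_trans cW; apply: leq_trans (leq_imset_card (fun w => [set u; v; w]) _).
apply/subset_leq_card/subsetP => A; rewrite inE => /and3P[DA Au Av].
have /eqP/cards1P[w defA] : #|A :\ u :\ v| = 1.
  have := uniform_design DA; rewrite (cardsD1 u) Au => -[]; rewrite (cardsD1 v).
  by rewrite !inE Av eq_sym uv => -[].
have /setD1P[wv /setD1P[wu Aw]] : w \in A :\ u :\ v by rewrite defA inE.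
apply/imsetP; exists w.
  by rewrite inE wu wv /= (designP DA) // eq_sym.
apply/esym/eqP; rewrite eqEcard !subUset !sub1set Au Av Aw (uniform_design DA) /=.
by rewrite -setUA !cardsU1 !inE cards1 negb_or uv eq_sym wu [v == w]eq_sym wv.
Qed.

(** A core of size 0 or 1 would need 21 or 15 points, more than 14; a core of size 2 is excluded by
    the codegree. *)
Lemma sunflower_free_design : sunflower_free 7 design.
Proof.
move=> S sS [cS [C coreS]]; have S1 : 1 < #|S| by rewrite cS.
have [cC] := sunflower_vertices (uniformS sS uniform_design) S1 coreS.
rewrite cS card_ord => leC; have /eqP/cards2P[u [v [uv defC]]] : #|C| = 2.
  by move: cC leC; move: #|C|; clear; lia.
have : S \subset [set A in design | (u \in A) && (v \in A)].
  apply/subsetP => A SA; rewrite inE (subsetP sS) //=.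
  by have := core_sub S1 coreS SA; rewrite defC subUset !sub1set.
by move/subset_leq_card; rewrite cS leqNgt ltnS design_codeg.
Qed.

Lemma matching_le_design : matching_le design 4.
Proof. by apply: matching_le_vertices uniform_design _; rewrite card_ord. Qed.

Lemma card_design : 182 <= #|design|.
Proof.
pose P (t : 'I_14 * 'I_14 * 'I_14) :=
  [&& t.1.1 < t.1.2, t.1.2 < t.2 & square_triple t.1.1 t.1.2 t.2].
pose g (t : 'I_14 * 'I_14 * 'I_14) := [set t.1.1; t.1.2; t.2].
have cP : #|[set t | P t]| = 182.
  rewrite -sum1_card big_mkcond /=.
  under eq_bigr => t _ do rewrite inE.
  rewrite -(pair_bigA _ (fun p k => if P (p, k) then 1 else 0)) /=.
  rewrite -(pair_bigA _ (fun i j => \sum_k if P (i, j, k) then 1 else 0)) /=.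
  pose h i j k := nat_of_bool [&& i < j, j < k & square_triple i j k].
  (* Sums over ordinals become sums of lists of naturals, which can be evaluated. *)
  transitivity (\sum_(i < 14) sumn [seq sumn [seq h i j k | k <- iota 0 14] | j <- iota 0 14]).
    apply: eq_bigr => i _; rewrite -sum_ord_sumn; apply: eq_bigr => j _.
    by rewrite -sum_ord_sumn.
  rewrite (sum_ord_sumn 14
    (fun i => sumn [seq sumn [seq h i j k | k <- iota 0 14] | j <- iota 0 14])).
  by vm_compute.
rewrite -cP -(card_in_imset (f := g)).
  apply/subset_leq_card/subsetP => _ /imsetP[[[i j] k] + ->].
  rewrite inE => /and3P[/= ij jk q]; rewrite /g /= inE.
  have nij : i != j by rewrite -val_eqE /= ltn_eqF.
  have njk : j != k by rewrite -val_eqE /= ltn_eqF.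
  have nik : i != k by rewrite -val_eqE /= ltn_eqF // (ltn_trans ij).
  rewrite -setUA !cardsU1 !inE cards1 negb_or nij nik njk /=.
  (* Membership in [design] quantifies over all six orderings; [q1] to [q5] reduce the other five to
     the increasing one. *)
  have [q1 q2] := square_tripleC i j k.
  have [_ q3] := square_tripleC j i k.
  have [q4 _] := square_tripleC i k j.
  have [q5 _] := square_tripleC j k i.
  apply/forall_inP => u uA; apply/forall_inP => v vA; apply/forall_inP => w wA.
  apply/implyP => /and3P[]; move: uA vA wA; rewrite !inE.
  by do 3!case/or3P => /eqP->; rewrite ?eqxx //= -?q5 -?q4 -?q3 -?q2 -?q1.
move=> [[i j] k] [[i' j'] k']; rewrite !inE => /and3P[/= ij jk _] /and3P[/= ij' jk' _] eqg.
(* An increasing triple is determined by its set of points, so [g] is injective where [P] holds. *)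
have mem x : x \in [set i; j; k] -> x = i' :> nat \/ x = j' :> nat \/ x = k' :> nat.
  rewrite -[[set i; j; k]]/(g (i, j, k)) eqg /g /= !inE -orbA.
  by case/or3P => /eqP->; [left|right; left|right; right].
have := mem i; have := mem j; have := mem k; rewrite !inE !eqxx !orbT /=.
move=> /(_ isT) hk /(_ isT) hj /(_ isT) hi.
have [ei [ej ek]] : i = i' :> nat /\ j = j' :> nat /\ k = k' :> nat.
  by move: ij jk ij' jk' hi hj hk; case: i j k i' j' k' {eqg mem} =>
    [i _] [j _] [k _] [i' _] [j' _] [k' _] /=; clear; lia.
by rewrite (val_inj ei) (val_inj ej) (val_inj ek).
Qed.

Lemma sunflower_free_3_7_266 :
  exists (T : finType) (F : {set {set T}}),
    [/\ uniform 3 F, sunflower_free 7 F & 266 <= #|F|].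
Proof.
pose F2 := sum_family cone_2K7 cone_2K7.
have u2 : uniform 3 F2 := uniform_sum uniform_cone_2K7 uniform_cone_2K7.
have max2 : matching_le F2 2 := matching_le_sum (matching_le_cone (F:=_)) (matching_le_cone (F:=_)).
have free2 : sunflower_free 7 F2.
  by apply: sunflower_free_sum (matching_le_cone (F:=_)) (matching_le_cone (F:=_)) _ _ => //;
     apply: sunflower_free_cone_2K7.
exists _, (sum_family design F2); split.
- exact: uniform_sum uniform_design u2.
- exact: sunflower_free_sum sunflower_free_design free2 matching_le_design max2 _ _.
- rewrite (card_sum _ uniform_design) (card_sum _ uniform_cone_2K7) card_cone_2K7.
  by rewrite (leq_add card_design).
Qed.

Theorem theorem7p5 : 259 <= f 3 7 /\ f 3 7 <= 474.
Proof.
have [T0 [F0 [uF0 freeF0 cF0]]] := sunflower_free_3_7_266.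
(* The default value of [f] is excluded by exhibiting the maximum, which exists because the attained
   sizes are bounded by 474. *)
pose P n := `[< exists (T : finType) (F : {set {set T}}),
  [/\ uniform 3 F, sunflower_free 7 F & #|F| = n] >].
have exP : exists n, P n by exists #|F0|; apply/asboolP; exists T0, F0.
have ubP n : P n -> n <= 474.
  by move=> /asboolP[T [F [uF freeF <-]]]; apply: card_sunflower_free_3_7.
case: (ex_maxnP exP ubP) => m Pm maxm.
have max_m : is_sunflower_max 3 7 m.
  split; first exact/asboolP.
  by move=> T F uF freeF; apply: maxm; apply/asboolP; exists T, F.
rewrite (fE max_m) ubP //; split=> //.
by rewrite (leq_trans _ (max_m.2 _ _ uF0 freeF0)) // (leq_trans _ cF0).
Qed.
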